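(* Let $(E,\mathcal F,\mathcal L)$ be an oriented interval greedoid and $X\in\mathcal F$. Then $(\xi(X),\mathcal F|_{\xi(X)},\mathcal L|_{\xi(X)})$ is an oriented interval greedoid, where $\xi(X)=\xi([X])$ and $\mathcal L|_{\xi(X)}=\{\mathrm{res}_{\xi(X)}(\alpha):\alpha\in\mathcal L\}$.
   Context: Interval greedoid: finite $E$, nonempty family $\mathcal F$ with (IG1) each nonempty $X\in\mathcal F$ has $x$ with $X\setminus\{x\}\in\mathcal F$; (IG2) if $|X|>|Y|$ there is $x\in X\setminus Y$ with $Y\cup\{x\}\in\mathcal F$; (IG3) if $X\subseteq Y\subseteq Z$ in $\mathcal F$, $e\notin Z$, $X\cup\{e\},Z\cup\{e\}\in\mathcal F$, then $Y\cup\{e\}\in\mathcal F$. $\Gamma(X)=\{x\in E\setminus X:X\cup\{x\}\in\mathcal F\}$; $X\sim Y$ iff $\Gamma(X)=\Gamma(Y)$; classes $[X]$ are flats; $\Phi$ the set of flats ordered by $[X]\le[Y]$ iff there is $Z\subseteq E\setminus Y$ with $Y\cup Z\in\mathcal F$ and $Y\cup Z\sim X$ (a lattice). For a flat $A=[X]$: $\Gamma(A)=\Gamma(X)$, $\xi(A)=\bigcup_{X'\sim X}X'$; $\mu(S)=[X]$ for $X$ inclusion-maximal feasible in $S$; join $A\vee B=\mu(\xi(A)\cap\xi(B))$. A covector is $\alpha:E\to\{0,+,-,1\}$ such that for some flat $A=\mathrm{supp}(\alpha)$, $\alpha\in\{+,-\}$ on $\Gamma(A)$, $0$ on $\xi(A)$,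 $1$ elsewhere. Symbols ordered $0<+<1$, $0<-<1$. Product: with $C=\mathrm{supp}\,\alpha\vee\mathrm{supp}\,\beta$, $(\alpha\circ\beta)(e)=\beta(e)$ if $e\in\Gamma(C)\cup\xi(C)$ and $\beta(e)>\alpha(e)$; $\alpha(e)$ if $e\in\Gamma(C)\cup\xi(C)$ otherwise; $1$ otherwise. $-\alpha$ swaps $+,-$; $S(\alpha,\beta)=\{e:\alpha(e)=-\beta(e)\in\{+,-\}\}$. Oriented interval greedoid: $(E,\mathcal F,\mathcal L)$, $\mathcal L$ a set of covectors with (OG1) $\mathrm{supp}:\mathcal L\to\Phi$ surjective; (OG2) $-\mathcal L=\mathcal L$; (OG3) closed under $\circ$; (OG4) if $\alpha,\beta\in\mathcal L$, $x\in S(\alpha,\beta)$, $(\alpha\circ\beta)(x)\ne1$, some $\gamma\in\mathcal L$ has $\gamma(x)=0$ and $\gamma(y)=(\alpha\circ\beta)(y)=(\beta\circ\alpha)(y)$ for all $y\notin S(\alpha,\beta)$ with $(\alpha\circ\beta)(y)\neq1$. Restriction: for $W\subseteq E$, $\mathcal F|_W=\{X\in\mathcal F:X\subseteq W\}$; $(W,\mathcal F|_W)$ is an interval greedoid with its own $\Gamma|_W,\xi|_W,\mu|_W,\Phi|_W$. For $C\in\Phi$ put $C|_W=\mu|_W(W\cap\xi(C))$. For a covector $\alpha$ with $A=\mathrm{supp}(\alpha)$, $\mathrm{res}_W(\alpha):W\to\{0,+,-,1\}$ is $0$ on $\xi|_W(A|_W)$, equals $\alpha$ on $\Gamma|_W(A|_W)$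 (a subset of $\Gamma(A)$), and is $1$ elsewhere on $W$. *)

(* Defs.v *)
From HB Require Import structures.
From mathcomp Require Import all_boot.

Set Implicit Arguments.
Unset Strict Implicit.
Unset Printing Implicit Defensive.

(** * Interval greedoids *)

Record interval_greedoid (E : finType) (F : {set {set E}}) : Prop := {
  ig_nonempty : F != set0;
  ig1 : forall X : {set E}, X \in F -> X != set0 ->
    exists2 x, x \in X & X :\ x \in F;
  ig2 : forall X Y : {set E}, X \in F -> Y \in F -> #|Y| < #|X| ->
    exists2 x, x \in X :\: Y & x |: Y \in F;
  ig3 : forall (X Y Z : {set E}) (e : E),
    X \in F -> Y \in F -> Z \in F -> X \subset Y -> Y \subset Z ->
    e \notin Z -> e |: X \in F -> e |: Z \in F -> e |: Y \in F
}.

Definition Gamma (E : finType) (F : {set {set E}}) (X : {set E}) : {set E} :=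
  [set x | (x \notin X) && (x |: X \in F)].

(* The class [X] of a feasible set X; flats are represented as sets of
   feasible sets. *)
Definition flat_of (E : finType) (F : {set {set E}}) (X : {set E}) :
  {set {set E}} := [set Y in F | Gamma F Y == Gamma F X].

Definition flats (E : finType) (F : {set {set E}}) : {set {set {set E}}} :=
  [set flat_of F X | X in F].

(* All members of a flat have the same Gamma, so the union below is that
   common value (lemma [Gamma_flat_of]). *)
Definition Gamma_flat (E : finType) (F : {set {set E}}) (A : {set {set E}}) :
  {set E} := \bigcup_(X in A) Gamma F X.

Definition xi (E : finType) (A : {set {set E}}) : {set E} :=
  \bigcup_(X in A) X.

Definition max_feasible_in (E : finType) (F : {set {set E}}) (S X : {set E}) :
  bool := maxset (fun Y : {set E} => (Y \in F) && (Y \subset S)) X.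

(* In an interval greedoid some maximal X exists and the class does not depend
   on its choice (lemmas [max_feasible_exists] and [mu_max_feasible]). *)
Definition mu (E : finType) (F : {set {set E}}) (S : {set E}) :
  {set {set E}} := flat_of F (odflt set0 [pick X | max_feasible_in F S X]).

Definition join (E : finType) (F : {set {set E}}) (A B : {set {set E}}) :
  {set {set E}} := mu F (xi A :&: xi B).

(** * Covectors *)

Inductive symbol := Zero | Plus | Minus | One.

Definition symbol_code (s : symbol) : bool * bool :=
  match s with
  | Zero => (false, false) | Plus => (true, false)
  | Minus => (false, true) | One => (true, true)
  end.

Definition symbol_decode (c : bool * bool) : symbol :=
  match c with
  | (false, false) => Zero | (true, false) => Plus
  | (false, true) => Minus | (true, true) => One
  end.

Lemma symbol_codeK : cancel symbol_code symbol_decode.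
Proof. by case. Qed.

HB.instance Definition _ := Finite.copy symbol (can_type symbol_codeK).

(* The strict partial order generated by 0 < + < 1 and 0 < - < 1. *)
Definition symbol_lt (s t : symbol) : bool :=
  match s, t with
  | Zero, (Plus | Minus | One) => true
  | (Plus | Minus), One => true
  | _, _ => false
  end.

Definition symbol_opp (s : symbol) : symbol :=
  match s with Plus => Minus | Minus => Plus | Zero => Zero | One => One end.

Definition signed (s : symbol) : bool := (s == Plus) || (s == Minus).

Definition covector_on (E : finType) (F : {set {set E}}) (A : {set {set E}})
  (a : {ffun E -> symbol}) : bool :=
  [forall e, if e \in Gamma_flat F A then signed (a e)
             else if e \in xi A then a e == Zero
             else a e == One].

Definition is_covector (E : finType) (F : {set {set E}})
  (a : {ffun E -> symbol}) : bool :=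
  [exists A in flats F, covector_on F A a].

(* Junk value set0 if a is not a covector; otherwise the flat is unique
   (lemma [supp_covector_on]). *)
Definition supp (E : finType) (F : {set {set E}}) (a : {ffun E -> symbol}) :
  {set {set E}} := odflt set0 [pick A in flats F | covector_on F A a].

Definition covector_prod (E : finType) (F : {set {set E}})
  (a b : {ffun E -> symbol}) : {ffun E -> symbol} :=
  let C := join F (supp F a) (supp F b) in
  [ffun e => if e \in Gamma_flat F C :|: xi C then
               if symbol_lt (a e) (b e) then b e else a e
             else One].

Definition covector_opp (E : finType) (a : {ffun E -> symbol}) :
  {ffun E -> symbol} := [ffun e => symbol_opp (a e)].

Definition separation (E : finType) (a b : {ffun E -> symbol}) : {set E} :=
  [set e | signed (a e) && (a e == symbol_opp (b e))].

(** * Oriented interval greedoids *)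

Record oriented_interval_greedoid (E : finType) (F : {set {set E}})
    (L : {set {ffun E -> symbol}}) : Prop := {
  og_greedoid : interval_greedoid F;
  og_covector : forall a, a \in L -> is_covector F a;
  og1 : forall A, A \in flats F -> exists2 a, a \in L & supp F a = A;
  og2 : [set covector_opp a | a in L] = L;
  og3 : forall a b, a \in L -> b \in L -> covector_prod F a b \in L;
  og4 : forall a b x, a \in L -> b \in L -> x \in separation a b ->
    covector_prod F a b x <> One ->
    exists c, [/\ c \in L, c x = Zero &
      forall y, y \notin separation a b -> covector_prod F a b y <> One ->
        c y = covector_prod F a b y /\
        covector_prod F a b y = covector_prod F b a y]
}.

(** * Restriction *)

(* The ground set of a restriction to W is the finite type of elements of W;
   subsets of W are identified with sets over this type through
   [val @: _] and [val @^-1: _]. *)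
Definition ground (E : finType) (W : {set E}) : finType := {x : E | x \in W}.

Definition restrict_feasible (E : finType) (F : {set {set E}}) (W : {set E}) :
  {set {set ground W}} :=
  [set Y : {set ground W} | [set val y | y in Y] \in F].

Definition restrict_flat (E : finType) (F : {set {set E}}) (W : {set E})
  (C : {set {set E}}) : {set {set ground W}} :=
  mu (restrict_feasible F W) [set w : ground W | val w \in xi C].

Definition restrict_covector (E : finType) (F : {set {set E}}) (W : {set E})
  (a : {ffun E -> symbol}) : {ffun ground W -> symbol} :=
  let A := restrict_flat F W (supp F a) in
  [ffun w => if w \in xi A then Zero
             else if w \in Gamma_flat (restrict_feasible F W) A then a (val w)
             else One].

Definition restrict_covectors (E : finType) (F : {set {set E}}) (W : {set E})
  (L : {set {ffun E -> symbol}}) : {set {ffun ground W -> symbol}} :=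
  [set restrict_covector F W a | a in L].

(** * Well-definedness *)

Lemma mem_flat_of (E : finType) (F : {set {set E}}) (X : {set E}) :
  X \in F -> X \in flat_of F X.
Proof. by move=> XF; rewrite inE XF eqxx. Qed.

Lemma Gamma_flat_of (E : finType) (F : {set {set E}}) (X : {set E}) :
  X \in F -> Gamma_flat F (flat_of F X) = Gamma F X.
Proof.
move=> XF; apply/setP=> e; apply/bigcupP/idP => [[Y]|eX].
  by rewrite inE => /andP[_ /eqP->].
by exists X => //; apply: mem_flat_of.
Qed.

Lemma Gamma_xi_disjoint (E : finType) (F : {set {set E}}) (X : {set E}) :
  X \in F -> [disjoint Gamma_flat F (flat_of F X) & xi (flat_of F X)].
Proof.
move=> XF; rewrite Gamma_flat_of // disjoint_subset.
apply/subsetP=> e eX; rewrite inE; apply/negP => /bigcupP[Y].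
by rewrite inE => /andP[_ /eqP YX] eY; move: eX; rewrite -YX inE eY.
Qed.

Lemma max_feasible_exists (E : finType) (F : {set {set E}}) (S : {set E}) :
  interval_greedoid F -> exists X, max_feasible_in F S X.
Proof.
move=> G; have F0 : set0 \in F.
  case/set0Pn: (ig_nonempty G) => X; move: {2}#|X| (leqnn #|X|) => n.
  elim: n X => [|n IHn] X; first by rewrite leqn0 cards_eq0 => /eqP->.
  move=> leX XF; have [<- //|X0] := eqVneq X set0.
  have [x xX XxF] := ig1 G XF X0; apply: IHn XxF.
  by move: leX; rewrite (cardsD1 x) xX.
have P0 : (set0 \in F) && (set0 \subset S) by rewrite F0 sub0set.
by have [X mX _] := maxset_exists (P := fun Y => (Y \in F) && (Y \subset S)) P0;
  exists X.
Qed.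

Lemma mu_max_feasible (E : finType) (F : {set {set E}}) (S X : {set E}) :
  interval_greedoid F -> max_feasible_in F S X -> mu F S = flat_of F X.
Proof.
move=> G.
have sub A B : max_feasible_in F S A -> max_feasible_in F S B ->
    Gamma F A \subset Gamma F B.
  move=> /maxsetP[/andP[AF AS] Am] /maxsetP[/andP[BF BS] Bm].
  have leBA : #|B| <= #|A|.
    rewrite leqNgt; apply/negP => /(ig2 G BF AF)[x].
    rewrite inE => /andP[xA xB] xAF.
    have xS : x |: A \subset S by rewrite subUset sub1set (subsetP BS).
    have := Am (x |: A); rewrite xAF xS => /(_ isT (subsetUr _ _)) e.
    by move: xA; rewrite -e setU11.
  apply/subsetP=> e; rewrite !inE => /andP[eA eAF].
  have [|x] := ig2 G eAF BF; first by rewrite cardsU1 eA.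
  rewrite !inE => /andP[xB /orP[/eqP xe|xA]] xBF; first by rewrite -xe xB.
  have xS : x |: B \subset S by rewrite subUset sub1set (subsetP AS).
  have := Bm (x |: B); rewrite xBF xS => /(_ isT (subsetUr _ _)) eB.
  by move: xB; rewrite -eB setU11.
move=> mX; rewrite /mu; case: pickP => [Y mY|/(_ X)]; last by rewrite mX.
have eG : Gamma F Y = Gamma F X by apply/eqP; rewrite eqEsubset !sub.
by apply/setP=> Z; rewrite !inE /= eG.
Qed.

Lemma supp_covector_on (E : finType) (F : {set {set E}}) (A : {set {set E}})
  (a : {ffun E -> symbol}) :
  A \in flats F -> covector_on F A a -> supp F a = A.
Proof.
have key B : B \in flats F -> covector_on F B a ->
    B = [set X in F | Gamma F X == [set e | signed (a e)]].
  case/imsetP=> Y YF -> /forallP h; apply/setP=> X.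
  rewrite !inE; congr (_ && (_ == _)); apply/setP=> e; rewrite [RHS]inE.
  have := h e; rewrite Gamma_flat_of //; case: ifP => // _.
  by case: ifP => _ /eqP->.
move=> Af Aa; rewrite /supp; case: pickP => [B /andP[Bf Ba]|/(_ A)].
  by rewrite /= (key A Af Aa) (key B Bf Ba).
by rewrite Af Aa.
Qed.

(* Main.v *)
Require Import Defs.
From mathcomp Require Import all_boot.

(** Put [W = xi [X]]. Two feasible subsets of [W] are equivalent in the restriction
    iff they are equivalent in [F], and [xi [Y]] lies in [W] for every feasible
    [Y] inside [W]; so the flats of the restriction are the flats of [F] above [X],
    with [xi] unchanged and [Gamma] intersected with [W]. If [c] is a covector of
    support [X], the restriction of [a] is the plain restriction to [W] of [a o c].
    Hence the restricted covectors are the plain restrictions of the covectors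
    with [xi (supp a)] inside [W], and these commute with negation and products.
    For (OG4) the covector obtained in [L] is restricted in the same way. *)

(** * Flats of an interval greedoid and their [xi] and [Gamma] *)

Section Flats.

Set Implicit Arguments.
Unset Strict Implicit.

Context {E : finType} {F : {set {set E}}}.
Hypothesis G : interval_greedoid F.
Implicit Types (S T X Y : {set E}) (A B : {set {set E}}).

Lemma flat_of_eq X Y :
  X \in F -> (flat_of F Y == flat_of F X) = (Gamma F Y == Gamma F X).
Proof.
move=> XF; apply/eqP/eqP => [YX|YX]; last by apply/setP=> Z; rewrite !inE YX.
by have := mem_flat_of XF; rewrite -YX inE => /andP[_ /eqP].
Qed.

Lemma sub_xi X : X \in F -> X \subset xi (flat_of F X).
Proof. by move=> XF; apply: bigcup_sup; apply: mem_flat_of. Qed.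

Lemma Gamma_xiF X e : X \in F -> e \in Gamma F X -> e \in xi (flat_of F X) = false.
Proof.
by move=> XF eX; have := Gamma_xi_disjoint XF; rewrite Gamma_flat_of // =>
  /disjointFr->.
Qed.

(** Iterated (IG2): elements of [X] are added to [Y] until the sizes agree. *)
Lemma augment X Y : X \in F -> Y \in F -> #|Y| <= #|X| ->
  exists T, [/\ T \in F, Y \subset T, T \subset Y :|: X & #|T| = #|X|].
Proof.
move=> XF; move: {2}(#|X| - #|Y|) (erefl (#|X| - #|Y|)) => n.
elim: n Y => [|n IHn] Y eXY YF leYX.
  exists Y; split=> //; first exact: subsetUl.
  by apply/eqP; rewrite eqn_leq leYX -subn_eq0 eXY.
have ltYX : #|Y| < #|X| by rewrite -subn_gt0 eXY.
have [x] := ig2 G XF YF ltYX; rewrite inE => /andP[xY xX] xYF.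
have cxY : #|x |: Y| = #|Y|.+1 by rewrite cardsU1 xY.
have [|||T [TF xYT TX cT]] := IHn (x |: Y) => //; try by rewrite cxY ?subnS ?eXY.
exists T; split=> //; first exact: subset_trans (subsetUr _ _) xYT.
by apply: subset_trans TX _; rewrite !subUset sub1set inE xX orbT subsetUl subsetUr.
Qed.

(** Exchanging from a larger [Y] into [X] would yield an element of [Gamma F X] lying in [xi [X]],
    although these two sets are disjoint. *)
Lemma card_sub_xi X Y : X \in F -> Y \in F -> Y \subset xi (flat_of F X) ->
  #|Y| <= #|X|.
Proof.
move=> XF YF YX; rewrite leqNgt; apply/negP => /(ig2 G YF XF)[y].
rewrite inE => /andP[yX yY] yXF.
have := @Gamma_xiF X y XF; rewrite inE yX yXF (subsetP YX _ yY); by move/(_ isT).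
Qed.

Lemma basis_max_feasible X Y : X \in F -> Y \in F -> Y \subset xi (flat_of F X) ->
  #|Y| = #|X| -> max_feasible_in F (xi (flat_of F X)) Y.
Proof.
move=> XF YF YX cY; apply/maxsetP; split=> [|Z /andP[ZF ZX] YZ].
  by rewrite YF YX.
by apply/esym/eqP; rewrite eqEcard YZ cY card_sub_xi.
Qed.

(** Both sets are maximal feasible in [xi [X]], and [mu] does not depend on the choice of such a
    set. *)
Lemma basis_flat X Y : X \in F -> Y \in F -> Y \subset xi (flat_of F X) ->
  #|Y| = #|X| -> flat_of F Y = flat_of F X.
Proof.
move=> XF YF YX cY.
rewrite -(mu_max_feasible G (basis_max_feasible XF YF YX cY)).
exact: mu_max_feasible G (basis_max_feasible XF XF (sub_xi XF) erefl).
Qed.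

Lemma mu_xi A : A \in flats F -> mu F (xi A) = A.
Proof.
case/imsetP=> X XF ->.
exact: mu_max_feasible G (basis_max_feasible XF XF (sub_xi XF) erefl).
Qed.

Lemma extend_basis X Y : X \in F -> Y \in F -> Y \subset xi (flat_of F X) ->
  exists T, [/\ T \in F, Y \subset T & flat_of F T = flat_of F X].
Proof.
move=> XF YF YX.
have [T [TF YT TX cT]] := augment XF YF (card_sub_xi XF YF YX).
exists T; split=> //; apply: basis_flat => //.
by apply: subset_trans TX _; rewrite subUset YX sub_xi.
Qed.

(** Extend [Y] to a basis [B] of [xi [X]]. If [e] neither lies in [B] nor extends it, then growing
    [e |: Y] inside [e |: B] to the size of [B] gives a [T] equivalent to [B], and [e] is in [T]. *)
Lemma Gamma_sub X Y : X \in F -> Y \in F -> Y \subset xi (flat_of F X) ->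
  Gamma F Y \subset Gamma F X :|: xi (flat_of F X).
Proof.
move=> XF YF /(extend_basis XF YF)[B [BF YB BX]].
have /eqP GBX : Gamma F B == Gamma F X by rewrite -flat_of_eq // BX.
apply/subsetP=> e; rewrite inE => /andP[eY eYF]; rewrite -GBX -BX in_setU.
have [//|eB /=] := boolP (e \in Gamma F B).
have [/(subsetP (sub_xi BF))//|eNB] := boolP (e \in B).
have eBF : e |: B \notin F by move: eB; rewrite inE eNB.
have [Yeq|neY] := eqVneq Y B; first by rewrite -Yeq eYF in eBF.
have ltYB : #|Y| < #|B| by apply: proper_card; rewrite properEneq neY.
have [|T [TF eYT TB cT]] := augment BF eYF; first by rewrite cardsU1 eY.
have eT : e \in T by rewrite (subsetP eYT) ?setU11.
have TeB : T \subset e |: B.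
  by apply: subset_trans TB _; rewrite -setUA setUS // subUset YB /=.
(* [T] misses exactly one element of [e |: B], and adding it back would make
   [e |: B] feasible. *)
have addT u : u \in B -> u \notin T -> u |: T \notin F.
  move=> uB uT; suff -> : u |: T = e |: B by [].
  apply/eqP; rewrite eqEcard subUset sub1set inE uB orbT TeB /=.
  by rewrite !cardsU1 eNB uT cT.
(* For [f] extending one of [T] and [B], exchange into the other set: the element added is [f],
   since adding [e] to [B] or an element of [B] to [T] would make [e |: B] feasible. *)
have TX : T \in flat_of F B.
  rewrite inE TF /=; apply/eqP/setP=> f; rewrite !inE.
  apply/andP/andP=> -[fN fF].
    have [|x] := ig2 G fF BF; first by rewrite cardsU1 fN cT.
    rewrite inE => /andP[xB]; rewrite !inE => /orP[/eqP xf|xT] xBF.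
      by rewrite -xf.
    move: (subsetP TeB _ xT); rewrite !inE (negPf xB) orbF => /eqP xe.
    by rewrite -xe xBF in eBF.
  have [|x] := ig2 G fF TF; first by rewrite cardsU1 fN cT.
  rewrite inE => /andP[xT]; rewrite !inE => /orP[/eqP xf|xB] xTF.
    by rewrite -xf.
  by have := addT x xB xT; rewrite xTF.
exact: (subsetP (bigcup_sup T TX)).
Qed.

(* Induction along a feasible chain [V] in [Y' ~ Y]: the next element [b] extends
   [V :\ b] but not a larger [T] equivalent to [Y], so by (IG3) it does not extend
   a basis [B] containing [T] either, and [Gamma_sub] puts it in [xi]. *)
Lemma xi_sub X Y : X \in F -> Y \in F -> Y \subset xi (flat_of F X) ->
  xi (flat_of F Y) \subset xi (flat_of F X).
Proof.
move=> XF YF YX; apply/bigcupsP=> Y' Y'Y.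
have Y'F : Y' \in F by move: Y'Y; rewrite inE => /andP[].
have Y'xi : Y' \subset xi (flat_of F Y) by apply: bigcup_sup.
suff H n (V : {set E}) : #|V| <= n -> V \in F -> V \subset Y' -> V \subset xi (flat_of F X).
  exact: H (leqnn _) Y'F (subxx _).
elim: n V => [|n IHn] V leV VF VY'.
  by move: leV; rewrite leqn0 cards_eq0 => /eqP->; rewrite sub0set.
have [->|V0] := eqVneq V set0; first exact: sub0set.
have [b bV VbF] := ig1 G VF V0.
have VbX : V :\ b \subset xi (flat_of F X).
  apply: IHn => //; first by move: leV; rewrite (cardsD1 b) bV.
  exact: subset_trans (subD1set _ _) VY'.
rewrite -(setD1K bV) subUset sub1set VbX andbT.
have VbY : V :\ b \subset xi (flat_of F Y).
  by apply: subset_trans (subD1set _ _) _; apply: subset_trans VY' _.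
have [T [TF VT TY cT]] := augment YF VbF (card_sub_xi YF VbF VbY).
have TYxi : T \subset xi (flat_of F Y).
  by apply: subset_trans TY _; rewrite subUset VbY sub_xi.
have TX : T \subset xi (flat_of F X).
  by apply: subset_trans TY _; rewrite subUset VbX.
have [B [BF TB BX]] := extend_basis XF TF TX.
have [/(subsetP TX)//|bT] := boolP (b \in T).
(* [T] already has the size of [Y], so [b |: T] would be too large to be feasible inside [xi
   [Y]]. *)
have bTF : b |: T \notin F.
  apply/negP=> bTF; have := card_sub_xi YF bTF.
  rewrite subUset sub1set TYxi (subsetP Y'xi) ?(subsetP VY') //=.
  by rewrite cardsU1 bT cT ltnn => /(_ isT).
have [|bB] := boolP (b \in B); first by rewrite -BX; apply/subsetP/sub_xi.
have bVF : b |: (V :\ b) \in F by rewrite setD1K.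
have bBF : b |: B \notin F.
  by apply: contra bTF => bBF; apply: (ig3 G VbF TF BF VT TB bB).
have := subsetP (Gamma_sub XF VbF VbX) b.
rewrite inE setD11 bVF in_setU => /(_ isT)/orP[|//].
have /eqP <- : Gamma F B == Gamma F X by rewrite -flat_of_eq // BX.
by rewrite inE (negPf bBF) andbF.
Qed.

Lemma mu_spec S : exists2 Y, max_feasible_in F S Y & mu F S = flat_of F Y.
Proof.
by have [Y mY] := max_feasible_exists S G; exists Y => //; apply: mu_max_feasible.
Qed.

Lemma mu_flats S : mu F S \in flats F.
Proof. by have [Y /maxsetP[/andP[YF _] _] ->] := mu_spec S; apply: imset_f. Qed.

Lemma feasible_sub_xi_mu S Y : Y \in F -> Y \subset S -> Y \subset xi (mu F S).
Proof.
move=> YF YS.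
have [|T mT YT] := maxset_exists (P := fun T => (T \in F) && (T \subset S)) (C := Y).
  by rewrite YF.
rewrite (mu_max_feasible G mT); apply: subset_trans YT _; apply: sub_xi.
by case/maxsetP: mT => /andP[].
Qed.

(** This property holds for each [xi A] and passes to intersections, so it applies to
    [xi A :&: xi B], the set whose [mu] is the join. *)
Definition xi_closed S :=
  forall Y, Y \in F -> Y \subset S -> xi (flat_of F Y) \subset S.

Lemma xi_closed_xi A : A \in flats F -> xi_closed (xi A).
Proof. by case/imsetP=> X XF -> Y; apply: xi_sub. Qed.

Lemma xi_closedI S T : xi_closed S -> xi_closed T -> xi_closed (S :&: T).
Proof.
by move=> hS hT Y YF; rewrite !subsetI => /andP[YS YT]; rewrite hS ?hT.
Qed.

Lemma xi_mu_sub S : xi_closed S -> xi (mu F S) \subset S.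
Proof. by move=> hS; have [Y /maxsetP[/andP[YF YS] _] ->] := mu_spec S; apply: hS. Qed.

Lemma flats_Gamma_xiF A e :
  A \in flats F -> e \in Gamma_flat F A -> e \in xi A = false.
Proof. by case/imsetP=> X XF ->; rewrite Gamma_flat_of //; apply: Gamma_xiF. Qed.

Lemma flats_Gamma_sub A B : A \in flats F -> B \in flats F -> xi B \subset xi A ->
  Gamma_flat F B \subset Gamma_flat F A :|: xi A.
Proof.
case/imsetP=> X XF -> /imsetP[Y YF ->] YX; rewrite !Gamma_flat_of //.
by apply: Gamma_sub => //; apply: subset_trans YX; apply: sub_xi.
Qed.

Lemma Gamma_mu_notin S e : e \in Gamma_flat F (mu F S) -> e \notin S.
Proof.
have [Y /maxsetP[/andP[YF YS] Ym] ->] := mu_spec S.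
rewrite Gamma_flat_of // inE => /andP[eY eYF]; apply: contra eY => eS.
by rewrite -(Ym (e |: Y)) ?setU11 ?subsetUr // eYF subUset sub1set eS YS.
Qed.

(** * Covectors, their opposites and their products *)

Lemma covector_flat a : is_covector F a ->
  supp F a \in flats F /\ covector_on F (supp F a) a.
Proof. by case/existsP=> A /andP[Af Aa]; rewrite (supp_covector_on Af Aa). Qed.

Lemma covector_onP A (a : {ffun E -> symbol}) e : A \in flats F -> covector_on F A a ->
  [/\ signed (a e) = (e \in Gamma_flat F A), (a e == Zero) = (e \in xi A)
    & (a e != One) = (e \in Gamma_flat F A :|: xi A)].
Proof.
move=> Af /forallP/(_ e); rewrite in_setU.
have := flats_Gamma_xiF (e := e) Af; case: (e \in Gamma_flat F A) => [/(_ isT)->|_] //.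
  by case: (a e).
by case: (e \in xi A) => /eqP->.
Qed.

Lemma covector_opp_on A a :
  covector_on F A a -> covector_on F A (covector_opp a).
Proof.
move=> /forallP h; apply/forallP=> e; rewrite ffunE.
by have := h e; case: ifP => _; [|case: ifP => _]; case: (a e).
Qed.

(** On [Gamma] of the join neither factor is [One], by [flats_Gamma_sub], and not both are [Zero],
    by maximality, so the product is signed there. On [xi] of the join both factors vanish. *)
Lemma covector_prod_on a b : is_covector F a -> is_covector F b ->
  covector_on F (join F (supp F a) (supp F b)) (covector_prod F a b).
Proof.
move=> /covector_flat[Af Aa] /covector_flat[Bf Bb].
rewrite /covector_prod; set A := supp F a in Af Aa *; set B := supp F b in Bf Bb *.
set C := join F A B.
have Cf : C \in flats F by apply: mu_flats.
have : xi C \subset xi A :&: xi B.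
  by apply/xi_mu_sub/xi_closedI; apply: xi_closed_xi.
rewrite subsetI => /andP[CA CB].
apply/forallP=> e; rewrite ffunE in_setU.
have [sa za oa] := covector_onP e Af Aa; have [sb zb ob] := covector_onP e Bf Bb.
case: ifPn => [eC|eC] /=.
  have := subsetP (flats_Gamma_sub Af Cf CA) e eC.
  have := subsetP (flats_Gamma_sub Bf Cf CB) e eC.
  have := Gamma_mu_notin eC; rewrite in_setI -oa -ob -za -zb.
  by rewrite eC; case: (a e); case: (b e).
rewrite (negPf eC) /=; case: ifPn => [eC'|/negPf-> //].
have := subsetP CA e eC'; have := subsetP CB e eC'; rewrite -za -zb.
by rewrite eC' => /eqP-> /eqP->.
Qed.

End Flats.

(** * Feasible sets and flats of the restriction to [W] *)

Section Restriction.

Set Implicit Arguments.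
Unset Strict Implicit.

Context {E : finType} {F : {set {set E}}}.
Hypothesis G : interval_greedoid F.
Variable W : {set E}.
Implicit Types (S X : {set E}) (Y Z : {set ground W}) (w : ground W).

Local Notation FW := (restrict_feasible F W).
Local Notation im Y := [set val y | y in Y : {set ground W}].
Local Notation pre S := [set w : ground W | val w \in S].

Lemma im_sub Y : im Y \subset W.
Proof. by apply/subsetP=> _ /imsetP[y _ ->]; apply: valP. Qed.

Lemma im_pre S : im (pre S) = S :&: W.
Proof.
apply/setP=> e; rewrite in_setI; apply/imsetP/andP=> [[w] | [eS eW]].
  by rewrite inE => wS ->; rewrite wS; split=> //; apply: valP.
by exists (Sub e eW); rewrite ?inE SubK.
Qed.

Lemma mem_im Y w : (val w \in im Y) = (w \in Y).
Proof. by rewrite mem_imset //; apply: val_inj. Qed.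

Lemma im_subset Y Z : (im Y \subset im Z) = (Y \subset Z).
Proof.
apply/idP/idP=> [/subsetP YZ|]; last exact: imsetS.
by apply/subsetP=> w; rewrite -!mem_im; apply: YZ.
Qed.

Lemma card_im Y : #|im Y| = #|Y|.
Proof. exact/card_imset/val_inj. Qed.

Lemma im_setU1 w Y : im (w |: Y) = val w |: im Y.
Proof. exact: imsetU1. Qed.

Lemma im_setD1 w Y : im (Y :\ w) = im Y :\ val w.
Proof.
apply/setP=> e; rewrite in_setD1; apply/imsetP/andP=> [[y]|[ew /imsetP[y yY ey]]].
  by rewrite in_setD1 => /andP[yw yY] ->; rewrite mem_im yY (inj_eq val_inj).
by exists y; rewrite // in_setD1 yY andbT -(inj_eq val_inj) -ey.
Qed.

Lemma mem_FW Y : (Y \in FW) = (im Y \in F).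
Proof. by rewrite inE. Qed.

Lemma restrict_greedoid : interval_greedoid FW.
Proof.
split.
- have [X /maxsetP[/andP[XF]]] := max_feasible_exists set0 G.
  rewrite subset0 => /eqP X0 _; apply/set0Pn; exists set0.
  by rewrite mem_FW imset0 -X0.
- move=> Y; rewrite mem_FW => YF /set0Pn[y yY].
  have [|_ /imsetP[x xY ->] xF] := ig1 G YF.
    by apply/set0Pn; exists (val y); rewrite mem_im.
  by exists x => //; rewrite mem_FW im_setD1.
- move=> Y Z; rewrite !mem_FW -!card_im => YF ZF /(ig2 G YF ZF)[x].
  rewrite inE => /andP[xZ /imsetP[y yY xE]]; move: xZ; rewrite xE.
  by rewrite mem_im -im_setU1 => yZ yF; exists y; rewrite ?mem_FW // inE yY yZ.
move=> X Y Z e; rewrite !mem_FW -!im_subset !im_setU1 -mem_im.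
exact: (ig3 G).
Qed.

Lemma Gamma_restrict Y w : (w \in Gamma FW Y) = (val w \in Gamma F (im Y)).
Proof. by rewrite !inE mem_im im_setU1. Qed.

(* Feasible subsets of [W] equivalent in the restriction have the same size, so
   exchanging [y |: Y] into [Z] either adds [y] or an element of [Y], and the
   latter lies in [W], where both sets have the same continuations. *)
Lemma flat_of_restrict Y Z : Y \in FW -> Z \in FW ->
  (flat_of FW Y == flat_of FW Z) = (flat_of F (im Y) == flat_of F (im Z)).
Proof.
move=> YF ZF; rewrite !flat_of_eq -?mem_FW //.
apply/eqP/eqP => [YZ|YZ]; last by apply/setP=> w; rewrite !Gamma_restrict YZ.
suff H Y' Z' : Y' \in FW -> Z' \in FW -> Gamma FW Y' = Gamma FW Z' ->
    Gamma F (im Y') \subset Gamma F (im Z').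
  by apply/eqP; rewrite eqEsubset !H.
move=> {YZ ZF YF Z Y} YF ZF YZ.
have notG y : y \in Y' -> val y |: im Z' \in F -> val y \in im Z'.
  move=> yY yZ; apply: contraLR yY => yZ'.
  have : y \in Gamma FW Z' by rewrite Gamma_restrict inE yZ'.
  by rewrite -YZ inE => /andP[].
have leZY : #|im Z'| <= #|im Y'|.
  rewrite leqNgt; apply/negP => lt.
  rewrite !mem_FW in YF ZF; have [x] := ig2 G ZF YF lt.
  rewrite inE => /andP[xY /imsetP[z zZ xz]] xF.
  have [zY zYF] : val z \notin im Y' /\ val z |: im Y' \in F by rewrite -xz.
  have : z \in Gamma FW Z' by rewrite -YZ Gamma_restrict inE zY.
  by rewrite inE zZ.
rewrite !mem_FW in YF ZF.
apply/subsetP=> e; rewrite inE => /andP[eY eYF].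
have [|x] := ig2 G eYF ZF; first by rewrite cardsU1 eY.
rewrite inE => /andP[xZ]; rewrite in_setU1 => /orP[/eqP<-|/imsetP[y yY xE]] xF.
  by rewrite inE xZ.
by rewrite xE in xZ xF; rewrite notG in xZ.
Qed.

Lemma max_feasible_pre S Y :
  max_feasible_in FW (pre S) Y -> max_feasible_in F (S :&: W) (im Y).
Proof.
move=> /maxsetP[/andP[YF YS] Ym]; apply/maxsetP; split.
  by rewrite -mem_FW YF -im_pre im_subset.
move=> T /andP[TF]; rewrite subsetI => /andP[TS /setIidPl TW] YT.
rewrite -TW -im_pre in TF YT *; congr (im _); apply: Ym; last by rewrite -im_subset.
by rewrite mem_FW TF -im_subset !im_pre setSI.
Qed.

Hypothesis WF : W \in [set xi A | A in flats F].

Lemma xi_closed_ground : @xi_closed E F W.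
Proof. by case/imsetP: WF => A Af ->; apply: xi_closed_xi. Qed.

(** A feasible set equivalent to [im Y] in [F] lies in [W] because [W] is [xi_closed], so it comes
    from a feasible set of the restriction. *)
Lemma xi_restrict Y w : Y \in FW ->
  (w \in xi (flat_of FW Y)) = (val w \in xi (flat_of F (im Y))).
Proof.
move=> YF; have YF' : im Y \in F by rewrite -mem_FW.
apply/bigcupP/bigcupP => [[Z ZY wZ]|[T TY wT]].
  exists (im Z); last by rewrite mem_im.
  move: ZY; rewrite inE -flat_of_eq // => /andP[ZF]; rewrite flat_of_restrict //.
  by rewrite flat_of_eq // inE -mem_FW ZF.
have TW : im (pre T) = T.
  rewrite im_pre; apply/setIidPl; apply: subset_trans (bigcup_sup T TY) _.
  by apply: xi_closed_ground => //; apply: im_sub.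
move: TY; rewrite inE => /andP[TF TY].
have TF' : pre T \in FW by rewrite mem_FW TW.
exists (pre T); last by rewrite inE.
by rewrite inE TF' -flat_of_eq // flat_of_restrict // TW flat_of_eq.
Qed.

Lemma xi_mu_pre S w : (w \in xi (mu FW (pre S))) = (val w \in xi (mu F (S :&: W))).
Proof.
have [Y mY ->] := mu_spec restrict_greedoid (pre S).
rewrite (mu_max_feasible G (max_feasible_pre mY)) xi_restrict //.
by case/maxsetP: mY => /andP[].
Qed.

Lemma Gamma_mu_pre S w :
  (w \in Gamma_flat FW (mu FW (pre S))) = (val w \in Gamma_flat F (mu F (S :&: W))).
Proof.
have [Y mY ->] := mu_spec restrict_greedoid (pre S).
have YF : Y \in FW by case/maxsetP: mY => /andP[].
rewrite (mu_max_feasible G (max_feasible_pre mY)) !Gamma_flat_of -?mem_FW //.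
exact: Gamma_restrict.
Qed.

Lemma xi_mu_pre_sub A : A \in flats F -> xi A \subset W ->
  xi (mu FW (pre (xi A))) = pre (xi A).
Proof.
move=> Af /setIidPl AW; apply/setP=> w; apply: etrans (xi_mu_pre _ w) _.
by rewrite AW (mu_xi G Af) inE.
Qed.

(** * Plain restriction of covectors to [W] *)

Definition proj (a : {ffun E -> symbol}) : {ffun ground W -> symbol} :=
  [ffun w => a (val w)].

Lemma projE a w : proj a w = a (val w).
Proof. exact: ffunE. Qed.

Lemma proj_covector a : is_covector F a -> xi (supp F a) \subset W ->
  covector_on FW (mu FW (pre (xi (supp F a)))) (proj a).
Proof.
move=> /covector_flat[Af /forallP Aa] /setIidPl AW; apply/forallP=> w.
by rewrite xi_mu_pre Gamma_mu_pre AW (mu_xi G Af) ffunE.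
Qed.

Lemma supp_proj a : is_covector F a -> xi (supp F a) \subset W ->
  supp FW (proj a) = mu FW (pre (xi (supp F a))).
Proof.
move=> ca aW; apply: supp_covector_on (proj_covector ca aW).
exact/mu_flats/restrict_greedoid.
Qed.

Lemma proj_prod a b : is_covector F a -> is_covector F b ->
  xi (supp F a) \subset W -> xi (supp F b) \subset W ->
  covector_prod FW (proj a) (proj b) = proj (covector_prod F a b).
Proof.
move=> ca cb aW bW; apply/ffunP=> w; rewrite !ffunE !supp_proj // /join.
have [Af _] := covector_flat ca; have [Bf _] := covector_flat cb.
have -> : xi (mu FW (pre (xi (supp F a)))) :&: xi (mu FW (pre (xi (supp F b)))) =
    pre (xi (supp F a) :&: xi (supp F b)).
  rewrite (congr2 (@setI _) (xi_mu_pre_sub Af aW) (xi_mu_pre_sub Bf bW)).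
  by apply/setP=> v; rewrite !inE.
rewrite !in_setU xi_mu_pre Gamma_mu_pre.
by have /setIidPl-> : xi (supp F a) :&: xi (supp F b) \subset W by rewrite subIset ?aW.
Qed.

Lemma supp_opp a : is_covector F a -> supp F (covector_opp a) = supp F a.
Proof. by case/covector_flat=> Af Aa; apply/supp_covector_on/covector_opp_on. Qed.

Lemma supp_prod a b : is_covector F a -> is_covector F b ->
  supp F (covector_prod F a b) = join F (supp F a) (supp F b).
Proof.
by move=> ca cb; apply: supp_covector_on (covector_prod_on G ca cb); apply: mu_flats.
Qed.

Lemma restrict_covectorE a w : restrict_covector F W a w =
  if val w \in xi (mu F (xi (supp F a) :&: W)) then Zero
  else if val w \in Gamma_flat F (mu F (xi (supp F a) :&: W)) then a (val w)
  else One.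
Proof. by rewrite ffunE xi_mu_pre Gamma_mu_pre. Qed.

Lemma restrict_covector_proj a : is_covector F a -> xi (supp F a) \subset W ->
  restrict_covector F W a = proj a.
Proof.
move=> ca /setIidPl aW; have [Af Aa] := covector_flat ca.
apply/ffunP=> w; rewrite restrict_covectorE aW (mu_xi G Af) ffunE.
have [sa za oa] := covector_onP (val w) Af Aa; rewrite -za -sa.
by case: (a _) sa za.
Qed.

(* [c] vanishes on [W], so composing with it on the right only intersects the
   support with [W]. *)
Lemma restrict_covector_prod a c : is_covector F a -> is_covector F c ->
  xi (supp F c) = W ->
  restrict_covector F W a = proj (covector_prod F a c).
Proof.
move=> ca cc cW; have [Af Aa] := covector_flat ca; have [Cf Cc] := covector_flat cc.
apply/ffunP=> w; rewrite restrict_covectorE ffunE.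
rewrite [X in _ = X]ffunE /join cW in_setU.
have [_ zc _] := covector_onP (val w) Cf Cc.
have /eqP-> : c (val w) == Zero by rewrite zc cW; apply: valP.
have [_ za _] := covector_onP (val w) Af Aa.
have := subsetP (xi_mu_sub G (xi_closedI (xi_closed_xi G Af) xi_closed_ground)) (val w).
case: ifP => [_ /(_ isT)|_ _]; last by rewrite orbF; case: (a _).
by rewrite in_setI -za orbT => /andP[/eqP-> _].
Qed.

(** * The oriented axioms for the restricted covectors *)

Variable L : {set {ffun E -> symbol}}.
Hypothesis LO : oriented_interval_greedoid F L.

Lemma mem_restrict_covectors b : reflect
  (exists a, [/\ a \in L, xi (supp F a) \subset W & b = proj a])
  (b \in restrict_covectors F W L).
Proof.
apply: (iffP imsetP) => [[a aL ->]|[a [aL aW ->]]]; last first.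
  by exists a; rewrite // restrict_covector_proj //; apply: og_covector LO _ aL.
(* (OG1) supplies [c] supported on the flat whose [xi] is [W]; (OG3) keeps [a o c] in [L]. *)
case/imsetP: WF => C Cf WC; have [c cL cC] := og1 LO Cf.
have ca := og_covector LO aL; have cc := og_covector LO cL.
exists (covector_prod F a c); split; first exact: og3 LO _ _ aL cL.
  rewrite supp_prod // /join cC -WC; apply: subset_trans (subsetIr (xi (supp F a)) W).
  apply: xi_mu_sub => //; apply: xi_closedI xi_closed_ground.
  by case: (covector_flat ca) => Af _; apply: xi_closed_xi.
by apply: restrict_covector_prod => //; rewrite cC.
Qed.

(* The eliminated covector need not be supported above [W]; its restriction
   keeps the required values because its zero set contains that of the join of
   the two supports. *)
Lemma restrict_elimination a b c x : a \in L -> b \in L -> c \in L ->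
  xi (supp F a) \subset W -> x \in W -> x \in separation a b ->
  covector_prod F a b x <> One -> c x = Zero ->
  (forall y, y \notin separation a b -> covector_prod F a b y <> One ->
    c y = covector_prod F a b y) ->
  forall w : ground W, val w = x \/ val w \notin separation a b ->
    covector_prod F a b (val w) <> One ->
    restrict_covector F W c w = c (val w).
Proof.
move=> aL bL cL aW xW xS px cx hc w hw pw.
have [ca cb cc] := And3 (og_covector LO aL) (og_covector LO bL) (og_covector LO cL).
have [Af Aa] := covector_flat ca; have [Bf Bb] := covector_flat cb.
have [Cf Cc] := covector_flat cc.
have pab := covector_prod_on G ca cb.
have [Y /maxsetP[/andP[YF YS] _] jE] := mu_spec G (xi (supp F a) :&: xi (supp F b)).
rewrite /join jE in pab.
have Jf : flat_of F Y \in flats F by apply: imset_f.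
have JS : xi (flat_of F Y) \subset xi (supp F a) :&: xi (supp F b).
  by apply: (xi_closedI (xi_closed_xi G Af) (xi_closed_xi G Bf)).
(* Where the product vanishes, so does [a]; such a point is not separating, hence [c] takes the
   value [Zero] of the product. *)
have JC : xi (flat_of F Y) \subset xi (supp F c) :&: W.
  rewrite subsetI andbC (subset_trans JS) /=; last by rewrite subIset ?aW.
  apply/subsetP=> y yJ; have := subsetP JS y yJ; rewrite in_setI.
  have [_ <- _] := covector_onP y Af Aa; have [_ <- _] := covector_onP y Bf Bb.
  have [_ pz _] := covector_onP y Jf pab; rewrite -pz in yJ.
  move=> /andP[/eqP ay _]; have [_ <- _] := covector_onP y Cf Cc.
  by rewrite hc ?(eqP yJ) // inE ay.
set D := mu F (xi (supp F c) :&: W).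
have Df : D \in flats F by apply: mu_flats.
have DC : xi D \subset xi (supp F c) :&: W.
  exact/(xi_mu_sub G)/(xi_closedI (xi_closed_xi G Cf) xi_closed_ground).
have JD : xi (flat_of F Y) \subset xi D.
  apply/bigcupsP=> T TY; apply: feasible_sub_xi_mu => //.
    by move: TY; rewrite inE => /andP[].
  by apply: subset_trans JC; apply: bigcup_sup.
rewrite restrict_covectorE -/D.
have [sc zc _] := covector_onP (val w) Cf Cc.
have [sp zp op] := covector_onP (val w) Jf pab.
case: ifPn => [wD|wD].
  by have := subsetP DC _ wD; rewrite in_setI -zc => /andP[/eqP->].
(* The product is not [One] at [w], and [xi] of the join lies in [xi D], which misses [w]; only
   [Gamma] of the join remains, and it is contained in [Gamma] of [D] together with [xi D]. *)
have wJ : val w \in Gamma F Y.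
  have /eqP := pw; rewrite op in_setU Gamma_flat_of // => /orP[//|wJ].
  by rewrite (subsetP JD) in wD.
have := subsetP (flats_Gamma_sub G Df Jf JD) (val w).
by rewrite Gamma_flat_of // in_setU (negPf wD) orbF => /(_ wJ) ->.
Qed.

Lemma restrict_oriented : oriented_interval_greedoid FW (restrict_covectors F W L).
Proof.
have LC a (aL : a \in L) : is_covector F a := og_covector LO aL.
split.
- exact: restrict_greedoid.
- move=> _ /mem_restrict_covectors[a [aL aW ->]]; apply/existsP.
  exists (mu FW (pre (xi (supp F a)))).
  by rewrite proj_covector ?LC // mu_flats //; apply: restrict_greedoid.
(* A flat of the restriction is lifted to the flat of [im Y] in [F], whose [xi] stays in [W]; a
   covector of [L] on it is then projected. *)
- move=> _ /imsetP[Y YF ->]; have YF' : im Y \in F by rewrite -mem_FW.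
  have Yf : flat_of F (im Y) \in flats F by apply: imset_f.
  have [a aL aY] := og1 LO Yf.
  have aW : xi (supp F a) \subset W.
    by rewrite aY; apply: xi_closed_ground => //; apply: im_sub.
  exists (proj a); first by apply/mem_restrict_covectors; exists a.
  rewrite supp_proj ?LC // aY -(mu_xi restrict_greedoid (imset_f _ YF)).
  by congr (mu _ _); apply/setP=> w; rewrite inE xi_restrict.
- have opp_in b : b \in restrict_covectors F W L ->
      covector_opp b \in restrict_covectors F W L.
    case/mem_restrict_covectors=> a [aL aW ->]; apply/mem_restrict_covectors.
    exists (covector_opp a); rewrite supp_opp ?LC //; split=> //.
      by rewrite -(og2 LO) imset_f.
    by apply/ffunP=> w; rewrite !ffunE.
  apply/setP=> b; apply/imsetP/idP => [[a aL ->]|bL]; first exact: opp_in.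
  exists (covector_opp b); first exact: opp_in.
  by apply/ffunP=> w; rewrite !ffunE; case: (b w).
- move=> ra rb /mem_restrict_covectors[a [aL aW ->]].
  case/mem_restrict_covectors=> b [bL bW ->]; apply/mem_restrict_covectors.
  exists (covector_prod F a b); rewrite proj_prod ?LC //.
  split=> //; first exact: og3 LO _ _ aL bL.
  rewrite supp_prod ?LC //; apply: subset_trans aW.
  apply: subset_trans (subsetIl _ (xi (supp F b))).
  have [Af _] := covector_flat (LC _ aL); have [Bf _] := covector_flat (LC _ bL).
  exact/(xi_mu_sub G)/(xi_closedI (xi_closed_xi G Af) (xi_closed_xi G Bf)).
move=> ra rb x /mem_restrict_covectors[a [aL aW ->]].
case/mem_restrict_covectors=> b [bL bW ->].
rewrite !proj_prod ?LC // => xS; rewrite projE => px.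
have sepE w : (w \in separation (proj a) (proj b)) = (val w \in separation a b).
  by rewrite !inE !ffunE.
rewrite sepE in xS.
have [c [cL cx hc]] := og4 LO aL bL xS px.
have H := restrict_elimination aL bL cL aW (valP x) xS px cx
  (fun y h1 h2 => proj1 (hc y h1 h2)).
exists (restrict_covector F W c); split; first exact: imset_f.
  by rewrite H //; left.
move=> y; rewrite sepE !projE => yS py.
have [cy ?] := hc _ yS py; split=> //.
by rewrite -cy; apply: H => //; right.
Qed.

End Restriction.

Theorem mainTheorem12 (E : finType) (F : {set {set E}})
  (L : {set {ffun E -> symbol}}) (X : {set E})
  (hL : oriented_interval_greedoid F L) (hX : X \in F) :
  oriented_interval_greedoid
    (restrict_feasible F (xi (flat_of F X)))
    (restrict_covectors F (xi (flat_of F X)) L).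
Proof.
apply: (restrict_oriented (og_greedoid hL) _ hL).
by apply: imset_f; apply: imset_f.
Qed.
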